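(* Let $G$ be a finite group, let $\tilde{\Omega}(G)$ be its ghost ring, and let $\Omega(G) \subseteq \tilde{\Omega}(G)$ be its Burnside ring, identified with its image under the mark homomorphism. Let $u$ be a unit of $\tilde{\Omega}(G)$. Then $u \in \Omega(G)$ if and only if, for each subgroup $H \leq G$, $u$ satisfies the system of linear equations $\mathcal{E}(H)$ over $\mathsf{GF}(2)$ (defined in the context).
   Context: Let $G$ be a finite group. The Burnside ring $\Omega(G)$ is the Grothendieck ring of the isomorphism classes $[X]$ of finite left $G$-sets $X$ with respect to disjoint union and direct product. The ghost ring $\tilde{\Omega}(G)$ is the ring (with pointwise operations) of functions from the set of subgroups of $G$ to $\mathbb{Z}$ that are constant on conjugacy classes of subgroups. The map sending $[X]$ to the function $H \mapsto \#\{x \in X : h.x = x \text{ for all } h \in H\}$ is an injective ring homomorphism $\Omega(G) \to \tilde{\Omega}(G)$, and $\Omega(G)$ is identified with its image. Let $H_1, \dots, H_r$ be representatives of the conjugacy classes of subgroups of $G$. The units of $\tilde{\Omega}(G)$ are exactly the functions in $\tilde{\Omega}(G)$ with all values in $\{+1,-1\}$. For a unit $u$, define $v_1, \dots, v_r \in \mathsf{GF}(2)$ by $u(H_i) = (-1)^{v_i}$. Definition of $\mathcal{E}(H)$. Let $H \leq G$ and $N = N_G(H)$. Let $R$ be the smallest normal subgroup of $N$ such that $H \leq R$ and $N/R$ is an elementary abelian $2$-group. Choose a basis $e_1, \dots, e_m$ of $E = N/R$ (as a $\mathsf{GF}(2)$-vector space, written multiplicatively). For $n \in N$ write $Rn =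 e_1^{\alpha_1(n)} \cdots e_m^{\alpha_m(n)}$ with unique $\alpha_k(n) \in \{0,1\}$. Let $p$ be the index such that $H$ is conjugate in $G$ to $H_p$, and, for $n \in N$, let $q(n)$ be the index such that $H\langle n\rangle$ is conjugate in $G$ to $H_{q(n)}$. For each coset $Hn \in N/H$ consider the equation over $\mathsf{GF}(2)$ $$\alpha_1(n)\, l_1 + \dots + \alpha_m(n)\, l_m + v_p + v_{q(n)} = 0$$ in the unknowns $l_1, \dots, l_m, v_1, \dots, v_r$. For each $k$, choosing $n_k \in N$ with $R n_k = e_k$ gives the equation $l_k + v_p + v_{q(n_k)} = 0$, which expresses $l_k$ in terms of the $v_i$. Substituting these expressions for $l_1, \dots, l_m$ into all the equations (for all cosets $Hn \in N/H$) yields a (possibly trivial) homogeneous linear system over $\mathsf{GF}(2)$ in the unknowns $v_1, \dots, v_r$ only; this system is $\mathcal{E}(H)$. (Equivalently, up to equivalence of systems, $(v_1,\dots,v_r)$ satisfies $\mathcal{E}(H)$ if and only if there exist $l_1, \dots, l_m \in \mathsf{GF}(2)$ such that all the displayed equations, for all $n \in N$, hold.) A unit $u$ of $\tilde{\Omega}(G)$ satisfies $\mathcal{E}(H)$ if the associated vector $(v_1, \dots, v_r)$ is a solution of $\mathcal{E}(H)$. *)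

(* Defs.v *)
From HB Require Import structures.
From mathcomp Require Import all_boot all_order all_fingroup all_algebra.
From mathcomp Require Import all_solvable.
From mathcomp Require Import boolp ring generic_quotient.

Set Implicit Arguments.
Unset Strict Implicit.
Unset Printing Implicit Defensive.

Import GroupScope GRing.Theory.
Local Open Scope ring_scope.
Local Open Scope quotient_scope.

Section GhostRing.
Variable G : finGroupType.

Definition class_constant : {pred {ffun {group G} -> int}} :=
  fun f => [forall H : {group G}, forall x : G, f (H :^ x)%G == f H].

Record ghost := Ghost {
  ghost_fun :> {ffun {group G} -> int};
  ghost_funP : ghost_fun \in class_constant }.

HB.instance Definition _ := [isSub for ghost_fun].
HB.instance Definition _ := [Choice of ghost by <:].

Lemma class_constantP (f : {ffun {group G} -> int}) :
  reflect (forall (H : {group G}) x, f (H :^ x)%G = f H)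
          (f \in class_constant).
Proof.
apply: (iffP forallP) => [h H x | h H]; last by apply/forallP => x; apply/eqP.
by have /forallP/(_ x)/eqP := h H.
Qed.

Fact class_constant_subring : subring_closed class_constant.
Proof.
split.
- by apply/class_constantP => H x; rewrite !ffunE.
- move=> f g /class_constantP hf /class_constantP hg.
  by apply/class_constantP => H x; rewrite !ffunE hf hg.
- move=> f g /class_constantP hf /class_constantP hg.
  by apply/class_constantP => H x; rewrite !ffunE hf hg.
Qed.

HB.instance Definition _ :=
  GRing.isSubringClosed.Build _ class_constant class_constant_subring.
HB.instance Definition _ :=
  GRing.SubChoice_isSubPzRing.Build _ class_constant ghost class_constant_subring.

Lemma ghost_eqP (u v : ghost) : u = v <-> forall H, u H = v H.
Proof.
split=> [-> // | h]; apply: val_inj; apply/ffunP => H; exact: h.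
Qed.
Lemma ghost0E (H : {group G}) : (0 : ghost) H = 0.
Proof. by rewrite -[LHS]/(val (0 : ghost) H) raddf0 ffunE. Qed.
Lemma ghost1E (H : {group G}) : (1 : ghost) H = 1.
Proof. by rewrite -[LHS]/(val (1 : ghost) H) rmorph1 ffunE. Qed.
Lemma ghostNE (u : ghost) H : (- u) H = - u H.
Proof. by rewrite -[LHS]/(val (- u) H) raddfN ffunE. Qed.
Lemma ghostDE (u v : ghost) H : (u + v) H = u H + v H.
Proof. by rewrite -[LHS]/(val (u + v) H) raddfD ffunE. Qed.
Lemma ghostME (u v : ghost) H : (u * v) H = u H * v H.
Proof. by rewrite -[LHS]/(val (u * v) H) rmorphM ffunE. Qed.

Fact ghost_mulC : @commutative ghost ghost *%R.
Proof. by move=> u v; apply/ghost_eqP => H; rewrite !ghostME mulrC. Qed.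
HB.instance Definition _ := GRing.PzRing_hasCommutativeMul.Build ghost ghost_mulC.

Fact ghost_oner_neq0 : (1 : ghost) != 0.
Proof.
apply/eqP => /ghost_eqP/(_ 1%G); by rewrite ghost1E ghost0E.
Qed.
HB.instance Definition _ :=
  GRing.PzSemiRing_isNonZero.Build ghost ghost_oner_neq0.

(* An invertible element has values in {1, -1}, hence is its own inverse. *)
Definition ghost_unit : {pred ghost} := fun u => u * u == 1.

Fact ghost_mulVx : {in ghost_unit, left_inverse 1 (@id ghost) *%R}.
Proof. by move=> u /eqP. Qed.
Fact ghost_unitPl (u v : ghost) : v * u = 1 -> ghost_unit u.
Proof.
move=> /ghost_eqP h; apply/eqP/ghost_eqP => H; rewrite ghostME ghost1E.
move: (h H); rewrite ghostME ghost1E => vu.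
have : u H \is a GRing.unit by apply/unitrPr; exists (v H); rewrite mulrC.
by case/orP => /eqP ->.
Qed.
Fact ghost_invr_out : {in [predC ghost_unit], (@id ghost) =1 id}.
Proof. by []. Qed.
HB.instance Definition _ := GRing.ComNzRing_hasMulInverse.Build ghost
  ghost_mulVx ghost_unitPl ghost_invr_out.

Lemma ghost_unitE (u : ghost) :
  u \is a GRing.unit <-> forall H, u H = 1 \/ u H = -1.
Proof.
split=> [/eqP/ghost_eqP h H | h]; last first.
  apply/eqP/ghost_eqP => H; rewrite ghostME ghost1E.
  by case: (h H) => ->; rewrite ?mulrNN mulr1.
move: (h H); rewrite ghostME ghost1E => /eqP; rewrite -expr2 sqrf_eq1.
by case/orP => /eqP; [left | right].
Qed.

End GhostRing.

Section Grothendieck.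
Variable S : comPzSemiRingType.

Definition groth_rel : rel (S * S) :=
  fun a b => `[< exists c, a.1 + b.2 + c = b.1 + a.2 + c >].

Fact groth_rel_refl : reflexive groth_rel.
Proof. by move=> a; apply/asboolP; exists 0. Qed.
Fact groth_rel_sym : symmetric groth_rel.
Proof.
by move=> a b; apply/asboolP/asboolP => -[c h]; exists c; rewrite h.
Qed.
Fact groth_rel_trans : transitive groth_rel.
Proof.
move=> b a d /asboolP[c h] /asboolP[c' h']; apply/asboolP.
exists (b.2 + c + (b.1 + c')).
transitivity ((a.1 + b.2 + c) + (b.1 + d.2 + c')); first by ring.
by rewrite h h'; ring.
Qed.
Canonical groth_equiv :=
  EquivRel groth_rel groth_rel_refl groth_rel_sym groth_rel_trans.

(* The class of (a, b) stands for the formal difference a - b. *)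
Definition groth := {eq_quot groth_equiv}.
HB.instance Definition _ := Choice.on groth.
HB.instance Definition _ := EqQuotient.on groth.

Lemma groth_piP (a b : S * S) :
  \pi_groth a = \pi_groth b <-> exists c, a.1 + b.2 + c = b.1 + a.2 + c.
Proof.
split=> [/eqP|h]; first by rewrite eqmodE => /asboolP.
by apply/eqP; rewrite eqmodE; apply/asboolP.
Qed.

Definition groth_zero : groth := \pi_groth (0, 0).
Definition groth_one : groth := \pi_groth (1, 0).
Definition groth_opp (x : groth) : groth := \pi_groth ((repr x).2, (repr x).1).
Definition groth_add (x y : groth) : groth :=
  \pi_groth ((repr x).1 + (repr y).1, (repr x).2 + (repr y).2).
Definition groth_mul (x y : groth) : groth :=
  \pi_groth ((repr x).1 * (repr y).1 + (repr x).2 * (repr y).2,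
       (repr x).1 * (repr y).2 + (repr x).2 * (repr y).1).

Lemma groth_repr_pi (a : S * S) : exists c,
  (repr (\pi_groth a)).1 + a.2 + c = a.1 + (repr (\pi_groth a)).2 + c.
Proof. by apply/groth_piP; rewrite reprK. Qed.

Lemma groth_opp_pi a1 a2 : groth_opp (\pi_groth (a1, a2)) = \pi_groth (a2, a1).
Proof.
have [c h] := groth_repr_pi (a1, a2); apply/groth_piP; exists c => /=.
by move: h => /= h; rewrite [_ + a1]addrC -h [a2 + _]addrC.
Qed.
Lemma groth_add_pi a1 a2 b1 b2 :
  groth_add (\pi_groth (a1, a2)) (\pi_groth (b1, b2)) = \pi_groth (a1 + b1, a2 + b2).
Proof.
have [c h] := groth_repr_pi (a1, a2); have [d k] := groth_repr_pi (b1, b2).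
apply/groth_piP; exists (c + d); rewrite /=; move: (repr _) h => [x1 x2] /= h.
move: (repr _) k => [y1 y2] /= k.
transitivity ((x1 + a2 + c) + (y1 + b2 + d)); first by ring.
by rewrite h k; ring.
Qed.
Lemma groth_mul_pi a1 a2 b1 b2 :
  groth_mul (\pi_groth (a1, a2)) (\pi_groth (b1, b2))
  = \pi_groth (a1 * b1 + a2 * b2, a1 * b2 + a2 * b1).
Proof.
have [c h] := groth_repr_pi (a1, a2); have [d k] := groth_repr_pi (b1, b2).
rewrite /groth_mul; move: (repr _) h => [x1 x2] /= h.
move: (repr _) k => [y1 y2] /= k.
transitivity (\pi_groth (a1 * y1 + a2 * y2, a1 * y2 + a2 * y1)).
  apply/groth_piP; exists (c * y1 + c * y2) => /=.
  transitivity ((x1 + a2 + c) * y1 + (a1 + x2 + c) * y2); first by ring.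
  by rewrite -h {1}h; ring.
apply/groth_piP; exists (d * a1 + d * a2) => /=.
transitivity ((y1 + b2 + d) * a1 + (b1 + y2 + d) * a2); first by ring.
by rewrite -k {1}k; ring.
Qed.

Lemma groth_ind (P : groth -> Prop) :
  (forall a1 a2, P (\pi_groth (a1, a2))) -> forall x, P x.
Proof. by move=> h x; rewrite -[x]reprK; case: (repr x). Qed.

Fact groth_addA : associative groth_add.
Proof.
elim/groth_ind=> a1 a2; elim/groth_ind=> b1 b2; elim/groth_ind=> c1 c2.
by rewrite !groth_add_pi !addrA.
Qed.
Fact groth_addC : commutative groth_add.
Proof.
elim/groth_ind=> a1 a2; elim/groth_ind=> b1 b2.
by rewrite !groth_add_pi addrC [a2 + _]addrC.
Qed.
Fact groth_add0 : left_id groth_zero groth_add.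
Proof. by elim/groth_ind=> a1 a2; rewrite groth_add_pi !add0r. Qed.
Fact groth_addN : left_inverse groth_zero groth_opp groth_add.
Proof.
elim/groth_ind=> a1 a2; rewrite groth_opp_pi groth_add_pi.
by apply/groth_piP; exists 0 => /=; ring.
Qed.
HB.instance Definition _ := GRing.isZmodule.Build groth
  groth_addA groth_addC groth_add0 groth_addN.

Fact groth_mulA : associative groth_mul.
Proof.
elim/groth_ind=> a1 a2; elim/groth_ind=> b1 b2; elim/groth_ind=> c1 c2.
by rewrite !groth_mul_pi; congr (\pi_groth (_, _)); ring.
Qed.
Fact groth_mulC : commutative groth_mul.
Proof.
elim/groth_ind=> a1 a2; elim/groth_ind=> b1 b2.
by rewrite !groth_mul_pi; congr (\pi_groth (_, _)); ring.
Qed.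
Fact groth_mul1 : left_id groth_one groth_mul.
Proof.
elim/groth_ind=> a1 a2; rewrite groth_mul_pi.
by congr (\pi_groth (_, _)); ring.
Qed.
Fact groth_mulDl : left_distributive groth_mul groth_add.
Proof.
elim/groth_ind=> a1 a2; elim/groth_ind=> b1 b2; elim/groth_ind=> c1 c2.
by rewrite !(groth_add_pi, groth_mul_pi); congr (\pi_groth (_, _)); ring.
Qed.
HB.instance Definition _ := GRing.Zmodule_isComPzRing.Build groth
  groth_mulA groth_mulC groth_mul1 groth_mulDl.

Definition groth_in (s : S) : groth := \pi_groth (s, 0).

Lemma groth_piE a1 a2 : \pi_groth (a1, a2) = groth_in a1 - groth_in a2.
Proof.
rewrite -[- _]/(groth_opp _) -[RHS]/(groth_add _ _).
by rewrite groth_opp_pi groth_add_pi addr0 add0r.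
Qed.

Variables (R : pzRingType) (f : {rmorphism S -> R}).

Definition groth_lift (x : groth) : R := f (repr x).1 - f (repr x).2.

Lemma groth_lift_pi a1 a2 : groth_lift (\pi_groth (a1, a2)) = f a1 - f a2.
Proof.
have [c h] := groth_repr_pi (a1, a2); rewrite /groth_lift.
move: (repr _) h => [x1 x2] /= /(congr1 f); rewrite !rmorphD => /addIr h.
by apply/eqP; rewrite subr_eq addrAC [_ == _]eq_sym subr_eq -h.
Qed.

Fact groth_lift_zmod : zmod_morphism groth_lift.
Proof.
elim/groth_ind=> a1 a2; elim/groth_ind=> b1 b2.
rewrite -[_ - _]/(groth_add _ (groth_opp _)).
rewrite groth_opp_pi groth_add_pi !groth_lift_pi !rmorphD opprB.
by rewrite addrACA -opprD.
Qed.
HB.instance Definition _ :=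
  GRing.isZmodMorphism.Build groth R groth_lift groth_lift_zmod.

Fact groth_lift_monoid : monoid_morphism groth_lift.
Proof.
split; first by rewrite -[1]/groth_one groth_lift_pi rmorph1 rmorph0 subr0.
elim/groth_ind=> a1 a2; elim/groth_ind=> b1 b2.
rewrite -[_ * _]/(groth_mul _ _) groth_mul_pi !groth_lift_pi.
rewrite !rmorphD !rmorphM mulrBl !mulrBr opprB opprD addrACA -!addrA.
by congr (_ + _); rewrite [RHS]addrC [RHS]addrACA -!addrA [f a2 * f b2 + _]addrC !addrA.
Qed.
HB.instance Definition _ :=
  GRing.isMonoidMorphism.Build groth R groth_lift groth_lift_monoid.

End Grothendieck.

Section BurnsideRing.
Variable G : finGroupType.

Record left_action (T : Type) := LeftAction {
  lact :> G -> T -> T;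
  lact1 : forall x, lact 1%g x = x;
  lactM : forall g h x, lact (g * h)%g x = lact g (lact h x) }.

Record gset := GSet {
  gset_sort :> finType;
  gset_act : left_action gset_sort }.

(* The library's actions are right actions. *)
Fact right_act1 (X : gset) : (fun x g => gset_act X g^-1%g x)^~ 1%g =1 id.
Proof. by move=> x; rewrite invg1 lact1. Qed.
Fact right_actM (X : gset) x : act_morph (fun x g => gset_act X g^-1%g x) x.
Proof. by move=> g h; rewrite invMg lactM. Qed.
Definition right_act (X : gset) : {action G &-> X} :=
  TotalAction (@right_act1 X) (@right_actM X).

Definition gset_iso (X Y : gset) : Prop :=
  exists2 f : X -> Y, bijective f &
    forall g x, f (gset_act X g x) = gset_act Y g (f x).

Lemma gset_iso_refl X : gset_iso X X.
Proof. by exists id => //; exists id. Qed.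
Lemma gset_iso_sym X Y : gset_iso X Y -> gset_iso Y X.
Proof.
case=> f [f' fK f'K] hf; exists f'; first by exists f.
by move=> y g; apply: (can_inj fK); rewrite hf !f'K.
Qed.
Lemma gset_iso_trans X Y Z : gset_iso X Y -> gset_iso Y Z -> gset_iso X Z.
Proof.
case=> f fb hf [h hb hh]; exists (h \o f); first exact: bij_comp.
by move=> x g; rewrite /= hf hh.
Qed.

Definition void_act : left_action void :=
  @LeftAction void (fun _ x => x) (fun=> erefl) (fun _ _ _ => erefl).
Definition gset0 := GSet void_act.

Definition unit_act : left_action unit :=
  @LeftAction unit (fun _ x => x) (fun=> erefl) (fun _ _ _ => erefl).
Definition gset1 := GSet unit_act.

Section Constructions.
Variables X Y : gset.

Definition sum_fun (g : G) (z : X + Y) : X + Y :=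
  match z with
  | inl x => inl (gset_act X g x)
  | inr y => inr (gset_act Y g y)
  end.
Fact sum_fun1 z : sum_fun 1%g z = z.
Proof. by case: z => z /=; rewrite lact1. Qed.
Fact sum_funM g h z : sum_fun (g * h)%g z = sum_fun g (sum_fun h z).
Proof. by case: z => z /=; rewrite lactM. Qed.
Definition gset_sum := GSet (LeftAction sum_fun1 sum_funM).

Definition prod_fun (g : G) (z : X * Y) : X * Y :=
  (gset_act X g z.1, gset_act Y g z.2).
Fact prod_fun1 z : prod_fun 1%g z = z.
Proof. by case: z => x y; rewrite /prod_fun !lact1. Qed.
Fact prod_funM g h z : prod_fun (g * h)%g z = prod_fun g (prod_fun h z).
Proof. by rewrite /prod_fun !lactM. Qed.
Definition gset_prod := GSet (LeftAction prod_fun1 prod_funM).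
End Constructions.

Lemma gset_sum_iso X X' Y Y' : gset_iso X X' -> gset_iso Y Y' ->
  gset_iso (gset_sum X Y) (gset_sum X' Y').
Proof.
case=> f [f' fK f'K] hf [h [h' hK h'K] hh].
exists (fun z : X + Y => match z with
  inl x => inl (f x) | inr y => inr (h y) end : X' + Y').
  exists (fun z : X' + Y' => match z with
    inl x => inl (f' x) | inr y => inr (h' y) end : X + Y);
  by case=> z; rewrite ?fK ?f'K ?hK ?h'K.
by move=> g [] z /=; rewrite ?hf ?hh.
Qed.
Lemma gset_prod_iso X X' Y Y' : gset_iso X X' -> gset_iso Y Y' ->
  gset_iso (gset_prod X Y) (gset_prod X' Y').
Proof.
case=> f [f' fK f'K] hf [h [h' hK h'K] hh].
exists (fun z : X * Y => (f z.1, h z.2) : X' * Y').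
  by exists (fun z : X' * Y' => (f' z.1, h' z.2) : X * Y);
     case=> x y /=; rewrite ?fK ?f'K ?hK ?h'K.
by move=> g [x y]; rewrite /= /prod_fun /= hf hh.
Qed.

(* Isomorphism classes are classes of actions on the types 'I_n, so as to form
   a small type; every finite G-set is isomorphic to one of these. *)
Definition gset_code := {n : nat & left_action 'I_n}.
Definition decode (c : gset_code) : gset := GSet (projT2 c).

Section Encode.
Variable X : gset.
Definition rank_fun (g : G) (i : 'I_#|X|) : 'I_#|X| :=
  enum_rank (gset_act X g (enum_val i)).
Fact rank_fun1 i : rank_fun 1%g i = i.
Proof. by rewrite /rank_fun lact1 enum_valK. Qed.
Fact rank_funM g h i : rank_fun (g * h)%g i = rank_fun g (rank_fun h i).
Proof. by rewrite /rank_fun lactM enum_rankK. Qed.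
Definition encode : gset_code := existT _ #|X| (LeftAction rank_fun1 rank_funM).

Lemma encode_iso : gset_iso (decode encode) X.
Proof.
exists (fun i : 'I_#|X| => enum_val i : X).
  by exists enum_rank; [exact: enum_valK | exact: enum_rankK].
by move=> g i; rewrite /= enum_rankK.
Qed.
End Encode.

Definition code_rel : rel {classic gset_code} :=
  fun c d => `[< gset_iso (decode c) (decode d) >].
Fact code_rel_refl : reflexive code_rel.
Proof. by move=> c; apply/asboolP; exact: gset_iso_refl. Qed.
Fact code_rel_sym : symmetric code_rel.
Proof. by move=> c d; apply/asboolP/asboolP; exact: gset_iso_sym. Qed.
Fact code_rel_trans : transitive code_rel.
Proof.
move=> d c e /asboolP h /asboolP k; apply/asboolP; exact: gset_iso_trans h k.
Qed.
Canonical code_equiv :=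
  EquivRel code_rel code_rel_refl code_rel_sym code_rel_trans.

Definition iso_class := {eq_quot code_equiv}.
HB.instance Definition _ := Choice.on iso_class.
HB.instance Definition _ := EqQuotient.on iso_class.

Definition class_of (X : gset) : iso_class := \pi_iso_class (encode X).
Definition class_repr (a : iso_class) : gset := decode (repr a).

Lemma class_ofP X Y : class_of X = class_of Y <-> gset_iso X Y.
Proof.
split=> [/eqP|h].
  rewrite eqmodE => /asboolP h.
  apply: gset_iso_trans (encode_iso Y); apply: gset_iso_trans h.
  exact/gset_iso_sym/encode_iso.
apply/eqP; rewrite eqmodE; apply/asboolP.
apply: gset_iso_trans (encode_iso X) _; apply: gset_iso_trans h _.
exact/gset_iso_sym/encode_iso.
Qed.
Lemma class_reprK a : class_of (class_repr a) = a.
Proof.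
rewrite -[RHS]reprK; apply/eqP; rewrite eqmodE; apply/asboolP.
exact: encode_iso.
Qed.
Lemma class_repr_iso X : gset_iso (class_repr (class_of X)) X.
Proof. by apply/class_ofP; rewrite class_reprK. Qed.
Lemma iso_class_ind (P : iso_class -> Prop) :
  (forall X, P (class_of X)) -> forall a, P a.
Proof. by move=> h a; rewrite -[a]class_reprK. Qed.

Definition class_add (a b : iso_class) : iso_class :=
  class_of (gset_sum (class_repr a) (class_repr b)).
Definition class_mul (a b : iso_class) : iso_class :=
  class_of (gset_prod (class_repr a) (class_repr b)).

Lemma class_addE X Y :
  class_add (class_of X) (class_of Y) = class_of (gset_sum X Y).
Proof. by apply/class_ofP; apply: gset_sum_iso; exact: class_repr_iso. Qed.
Lemma class_mulE X Y :
  class_mul (class_of X) (class_of Y) = class_of (gset_prod X Y).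
Proof. by apply/class_ofP; apply: gset_prod_iso; exact: class_repr_iso. Qed.

Fact class_addA : associative class_add.
Proof.
elim/iso_class_ind=> X; elim/iso_class_ind=> Y; elim/iso_class_ind=> Z.
rewrite !class_addE; apply/class_ofP.
exists (fun z : X + (Y + Z) => match z with
  inl x => inl (inl x) | inr (inl y) => inl (inr y) | inr (inr z) => inr z
  end : (X + Y) + Z).
  by exists (fun z : (X + Y) + Z => match z with
    inl (inl x) => inl x | inl (inr y) => inr (inl y) | inr z => inr (inr z)
    end : X + (Y + Z)); [case=> [|[]] | case=> [[]|]].
by move=> g [|[]].
Qed.
Fact class_addC : commutative class_add.
Proof.
elim/iso_class_ind=> X; elim/iso_class_ind=> Y.
rewrite !class_addE; apply/class_ofP.
exists (fun z : X + Y => match z with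
  inl x => inr x | inr y => inl y end : Y + X).
  by exists (fun z : Y + X => match z with
    inl x => inr x | inr y => inl y end : X + Y); case.
by move=> g [].
Qed.
Fact class_add0 : left_id (class_of gset0) class_add.
Proof.
elim/iso_class_ind=> X; rewrite !class_addE; apply/class_ofP.
exists (fun z : void + X => match z with
  inl x => match x with end | inr x => x end).
  by exists (fun x : X => inr x : void + X) => [[]|].
by move=> g [].
Qed.
HB.instance Definition _ :=
  GRing.isNmodule.Build iso_class class_addA class_addC class_add0.

Fact class_mulA : associative class_mul.
Proof.
elim/iso_class_ind=> X; elim/iso_class_ind=> Y; elim/iso_class_ind=> Z.
rewrite !class_mulE; apply/class_ofP.
exists (fun z : X * (Y * Z) => (z.1, z.2.1, z.2.2)) => //.
by exists (fun z : X * Y * Z => (z.1.1, (z.1.2, z.2))); [case=> ? [] | case=> -[]].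
Qed.
Fact class_mulC : commutative class_mul.
Proof.
elim/iso_class_ind=> X; elim/iso_class_ind=> Y.
rewrite !class_mulE; apply/class_ofP.
exists (fun z : X * Y => (z.2, z.1)) => //.
by exists (fun z : Y * X => (z.2, z.1)); case.
Qed.
Fact class_mul1 : left_id (class_of gset1) class_mul.
Proof.
elim/iso_class_ind=> X; rewrite !class_mulE; apply/class_ofP.
exists (fun z : unit * X => z.2) => //.
by exists (fun x : X => (tt, x)); [case=> -[] | ].
Qed.
Fact class_mulDl : left_distributive class_mul class_add.
Proof.
elim/iso_class_ind=> X; elim/iso_class_ind=> Y; elim/iso_class_ind=> Z.
rewrite !(class_addE, class_mulE); apply/class_ofP.
exists (fun z : (X + Y) * Z => match z.1 with
  inl x => inl (x, z.2) | inr y => inr (y, z.2) end : (X * Z) + (Y * Z)).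
  by exists (fun z : (X * Z) + (Y * Z) => match z with
    inl t => (inl t.1, t.2) | inr t => (inr t.1, t.2) end : (X + Y) * Z);
    [case=> [[]] | case=> [[]|[]]].
by move=> g [[]].
Qed.
Fact class_mul0 : left_zero (class_of gset0) class_mul.
Proof.
elim/iso_class_ind=> X; rewrite !class_mulE; apply/class_ofP.
exists (fun z : void * X => z.1) => //.
by exists (fun x : void => match x with end : void * X); case.
Qed.
HB.instance Definition _ := GRing.Nmodule_isComPzSemiRing.Build iso_class
  class_mulA class_mulC class_mul1 class_mulDl class_mul0.

Definition burnside := groth iso_class.
HB.instance Definition _ := GRing.ComPzRing.on burnside.

Definition fixed_points (X : gset) (H : {group G}) : {set X} :=
  [set x | [forall h in H, gset_act X h x == x]].

Lemma fixed_pointsE X H : fixed_points X H = 'Fix_(right_act X)(H).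
Proof.
apply/setP => x; rewrite inE; apply/forall_inP/afixP => [h g gH | h g gH].
  by apply/eqP/h; rewrite groupV.
by apply/eqP; rewrite -[g in LHS]invgK; apply: h; rewrite groupV.
Qed.

Lemma fixed_points_iso X Y H :
  gset_iso X Y -> #|fixed_points X H| = #|fixed_points Y H|.
Proof.
case=> f [f' fK f'K] hf; rewrite -(card_imset _ (can_inj fK)).
apply: eq_card => y; apply/imsetP/idP => [[x] | ].
  rewrite !inE => /forall_inP h ->; apply/forall_inP => g /h/eqP e.
  by rewrite -hf e.
rewrite inE => /forall_inP h; exists (f' y); last by rewrite f'K.
rewrite inE; apply/forall_inP => g /h/eqP e.
by apply/eqP; apply: (can_inj fK); rewrite hf !f'K.
Qed.

Fact mark_class_constant (X : gset) :
  [ffun H : {group G} => #|fixed_points X H|%:Z] \in @class_constant G.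
Proof.
apply/class_constantP => H x; rewrite !ffunE; congr Posz.
have xK : cancel (gset_act X x) (gset_act X x^-1%g).
  by move=> y; rewrite -lactM mulVg lact1.
rewrite -(card_imset _ (can_inj xK)); apply: eq_card => y.
apply/imsetP/idP => [[z] | ].
  rewrite !inE => /forall_inP h ->; apply/forall_inP => g gH.
  rewrite -lactM [(g * x)%g]conjgC lactM.
  by rewrite (eqP (h (g ^ x)%g _)) ?memJ_conjg.
rewrite inE => /forall_inP h; exists (gset_act X x^-1%g y).
  rewrite inE; apply/forall_inP => g; rewrite mem_conjg => /h/eqP e.
  rewrite -[in X in _ == X]e -!lactM conjgE invgK.
  by rewrite !mulgA mulVg mul1g.
by rewrite -lactM mulgV lact1.
Qed.
Definition gset_mark (X : gset) : ghost G := Ghost (mark_class_constant X).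

Lemma gset_markE X H : gset_mark X H = #|fixed_points X H|%:Z.
Proof. by rewrite /= ffunE. Qed.
Lemma gset_mark_iso X Y : gset_iso X Y -> gset_mark X = gset_mark Y.
Proof.
by move=> h; apply/ghost_eqP => H; rewrite !gset_markE (fixed_points_iso H h).
Qed.

Definition class_mark (a : iso_class) : ghost G := gset_mark (class_repr a).

Lemma class_markE X : class_mark (class_of X) = gset_mark X.
Proof. exact/gset_mark_iso/class_repr_iso. Qed.

Fact class_mark_nmod : nmod_morphism class_mark.
Proof.
split.
  rewrite -[0]/(class_of gset0) class_markE; apply/ghost_eqP => H.
  by rewrite gset_markE ghost0E eq_card0 // => -[].
elim/iso_class_ind=> X; elim/iso_class_ind=> Y.
rewrite -[class_of X + _]/(class_add _ _) class_addE !class_markE.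
apply/ghost_eqP => H; rewrite ghostDE !gset_markE -PoszD; congr Posz.
rewrite -!sum1_card big_sumType /=.
by congr (_ + _)%N; apply: eq_bigl => z; rewrite !inE.
Qed.
HB.instance Definition _ :=
  GRing.isNmodMorphism.Build iso_class (ghost G) class_mark class_mark_nmod.

Fact class_mark_monoid : monoid_morphism class_mark.
Proof.
split.
  rewrite -[1]/(class_of gset1) class_markE; apply/ghost_eqP => H.
  rewrite gset_markE ghost1E.
  rewrite (_ : fixed_points _ _ = setT) ?cardsT ?card_unit //.
  by apply/setP => x; rewrite !inE; apply/forall_inP.
elim/iso_class_ind=> X; elim/iso_class_ind=> Y.
rewrite -[class_of X * _]/(class_mul _ _) class_mulE !class_markE.
apply/ghost_eqP => H; rewrite ghostME !gset_markE -PoszM -cardsX.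
congr Posz; apply: eq_card => -[x y]; rewrite !inE /=.
apply/forall_inP/andP => [h | [/forall_inP h /forall_inP k] g gH].
  by split; apply/forall_inP => g /h; rewrite xpair_eqE => /andP[].
by rewrite xpair_eqE h ?k.
Qed.
HB.instance Definition _ :=
  GRing.isMonoidMorphism.Build iso_class (ghost G) class_mark class_mark_monoid.

Definition mark : {rmorphism burnside -> ghost G} := groth_lift class_mark.

Definition in_burnside (u : ghost G) : Prop := exists a : burnside, mark a = u.

Lemma in_burnsideP u :
  in_burnside u <-> exists X Y : gset, u = gset_mark X - gset_mark Y.
Proof.
split=> [[] | [X [Y ->]]].
  elim/groth_ind; elim/iso_class_ind=> X; elim/iso_class_ind=> Y <-.
  by exists X, Y; rewrite -!class_markE -(groth_lift_pi class_mark).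
exists (\pi_(groth iso_class) (class_of X, class_of Y)).
by rewrite -!class_markE -(groth_lift_pi class_mark).
Qed.

End BurnsideRing.

Section System.
Variable G : finGroupType.

Section Radical.
Variable H : {group G}.

Definition elem2_over : pred {group G} := fun K =>
  [&& H \subset K, K <| 'N(H) & 2.-abelem ('N(H) / K)].

Definition radical : {group G} :=
  [group of \bigcap_(K : {group G} | elem2_over K) K].

Lemma elem2_overP (K : {group G}) :
  reflect [/\ H \subset K, K <| 'N(H), [~: 'N(H), 'N(H)] \subset K
            & forall x, x \in 'N(H) -> (x ^+ 2)%g \in K] (elem2_over K).
Proof.
apply: (iffP and3P) => [[HK nK /(abelemP (isT : prime 2))[ab sq]] | [HK nK ab sq]].
  have nNK := normal_norm nK; split => // [|x xN].
    by rewrite -quotient_cents2.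
  apply: coset_idr; first by rewrite groupX // (subsetP nNK).
  by rewrite morphX ?(subsetP nNK) //= sq // mem_quotient.
have nNK := normal_norm nK; split => //; apply/(abelemP (isT : prime 2)); split.
  by rewrite /abelian quotient_cents2.
move=> _ /morphimP[x xnK xN ->].
by rewrite -morphX //= coset_id // sq.
Qed.

Lemma radicalP : elem2_over radical.
Proof.
apply/elem2_overP; split.
- by apply/bigcapsP => K /and3P[].
- apply/andP; split.
    have top : elem2_over 'N(H)%G.
      apply/elem2_overP; rewrite normG normal_refl der1_subG.
      by split=> // x; apply: groupX.
    exact: bigcap_inf top.
  apply: norms_bigcap; apply/bigcapsP => K.
  by move=> /and3P[_ /normal_norm].
- by apply/bigcapsP => K /elem2_overP[].
- by move=> x xN; apply/bigcapP => K /elem2_overP[_ _ _]; apply.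
Qed.

Lemma radical_min (K : {group G}) : elem2_over K -> radical \subset K.
Proof. by move=> h; apply: bigcap_inf h. Qed.

(* The product is the GF(2)-linear combination of the e k, written
   multiplicatively; 'F_2 coerces to nat with values 0 and 1. *)
Definition comb m (e : 'I_m -> coset_of radical) (a : {ffun 'I_m -> 'F_2}) :
  coset_of radical := (\prod_(k < m) e k ^+ a k)%g.

Record quotient_basis := QuotientBasis {
  qb_dim : nat;
  qb_vec :> 'I_qb_dim -> coset_of radical;
  qb_mem : forall k, qb_vec k \in ('N(H) / radical)%g;
  qb_span : forall z, z \in ('N(H) / radical)%g -> exists a, z = comb qb_vec a;
  qb_free : forall a, comb qb_vec a = 1%g -> a = 0;
  qb_lift : 'I_qb_dim -> G;
  qb_lift_mem : forall k, qb_lift k \in 'N(H);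
  qb_liftE : forall k, coset radical (qb_lift k) = qb_vec k }.

Definition alpha (e : quotient_basis) (n : G) : {ffun 'I_(qb_dim e) -> 'F_2} :=
  odflt 0 [pick a | coset radical n == comb e a].

End Radical.
Arguments qb_lift {H} q k.
Arguments qb_mem {H} q k.
Arguments qb_lift_mem {H} q k.
Arguments qb_liftE {H} q k.
Arguments qb_span {H} q z.

Record subgroup_reps := SubgroupReps {
  rep_num : nat;
  rep :> 'I_rep_num -> {group G};
  rep_cover : forall K : {group G},
    exists i, (K : {set G}) \in (rep i :^: [set: G])%g;
  rep_inj : forall i j, (rep j : {set G}) \in (rep i :^: [set: G])%g -> i = j }.

Definition rep_index (rs : subgroup_reps) (K : {group G}) : 'I_(rep_num rs) :=
  xchoose (rep_cover rs K).

Definition sign_vec (rs : subgroup_reps) (u : ghost G) :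
  'I_(rep_num rs) -> 'F_2 := fun i => if u (rs i) == -1 then 1 else 0.

Arguments sign_vec rs u i : clear implicits.

Section Equations.
Variables (rs : subgroup_reps) (H : {group G}) (e : quotient_basis H).

(* As n normalizes H, the join of H and <[n]> is the product set H<n>; the
   equation only depends on the coset Hn. *)
Definition E_eqn (n : G) (l : 'I_(qb_dim e) -> 'F_2)
    (v : 'I_(rep_num rs) -> 'F_2) : 'F_2 :=
  \sum_k alpha e n k * l k + v (rep_index rs H)
    + v (rep_index rs (H <*> <[n]>)%G).

(* l k, as expressed by the equation at n_k := qb_lift e k. *)
Definition E_subst (v : 'I_(rep_num rs) -> 'F_2) (k : 'I_(qb_dim e)) : 'F_2 :=
  - (v (rep_index rs H) + v (rep_index rs (H <*> <[qb_lift e k]>)%G)).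

Definition E_solution (v : 'I_(rep_num rs) -> 'F_2) : Prop :=
  forall n, n \in 'N(H) -> E_eqn n (E_subst v) v = 0.

End Equations.
Arguments E_eqn {rs H} e n l v.
Arguments E_subst {rs H} e v k.
Arguments E_solution {rs H} e v.

Definition satisfies_E (rs : subgroup_reps) (H : {group G})
  (e : quotient_basis H) (u : ghost G) : Prop := E_solution e (sign_vec rs u).

Section Basis.
Variables (H : {group G}) (e : quotient_basis H).
Let E := ('N(H) / radical H)%g.

Fact comb_mem a : comb e a \in E.
Proof. by apply: group_prod => k _; apply: groupX; exact: qb_mem. Qed.

Fact E_abelian : abelian E.
Proof. by have /and3P[_ _ /abelem_abelian] := radicalP H. Qed.
Fact E_square z : z \in E -> (z ^+ 2)%g = 1%g.
Proof. by have /and3P[_ _ /(abelemP (isT : prime 2))[_]] := radicalP H; apply. Qed.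

Fact combD a b : comb e (a + b) = (comb e a * comb e b)%g.
Proof.
suff [//] : comb e (a + b) = (comb e a * comb e b)%g /\ comb e a \in E.
rewrite /comb; elim/big_rec3: _ => [|k x y z _ [-> yE]]; first by rewrite mulg1.
have ek := qb_mem e k; split; last by rewrite groupM ?groupX.
rewrite !ffunE -(mulgA (e k ^+ a k)%g) (mulgA y).
rewrite (centsP E_abelian y yE (e k ^+ b k)%g) ?groupX //.
rewrite !mulgA -expgD; do 2 congr (_ * _)%g.
rewrite -(expg_mod _ (E_square ek)) -[RHS](expg_mod _ (E_square ek)).
by congr (_ ^+ _)%g; case: (a k) (b k) => [[|[|]] ?] // [[|[|]] ?].
Qed.

Lemma comb_inj : injective (comb e).
Proof.
move=> a b ab; apply/eqP; rewrite -subr_eq0; apply/eqP/(@qb_free _ e).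
have N2 : - b = b.
  by apply/ffunP=> k; rewrite ffunE; case: (b k) => [[|[|]] ?] //; apply: val_inj.
by rewrite combD N2 ab; exact: E_square (comb_mem b).
Qed.

Lemma alphaP n : n \in 'N(H) -> coset (radical H) n = comb e (alpha e n).
Proof.
move=> nN; rewrite /alpha; case: pickP => [a /eqP // | h].
have [a ea] := qb_span e _ (mem_quotient (radical H) nN).
by have := h a; rewrite ea eqxx.
Qed.

Lemma alpha_lift k j : alpha e (qb_lift e k) j = (k == j)%:R.
Proof.
suff -> : alpha e (qb_lift e k) = [ffun j => (k == j)%:R] by rewrite ffunE.
apply: comb_inj; rewrite -alphaP ?qb_lift_mem // qb_liftE /comb.
rewrite (big_only1 k) //= ?ffunE ?eqxx //.
by move=> i ik _; rewrite ffunE eq_sym (negPf ik).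
Qed.

Lemma E_solutionP rs (v : 'I_(rep_num rs) -> 'F_2) :
  E_solution e v <->
  exists l, forall n, n \in 'N(H) -> E_eqn e n l v = 0.
Proof.
split=> [h | [l h] n nN]; first by exists (E_subst e v).
rewrite -(h n nN) /E_eqn; do 2 congr (_ + _); apply: eq_bigr => k _.
congr (_ * _); have := h _ (qb_lift_mem e k); rewrite /E_eqn.
rewrite (bigD1 k) //= alpha_lift eqxx mul1r big1 ?addr0 => [/eqP|j].
  by rewrite -addrA addr_eq0 => /eqP ->.
by rewrite eq_sym alpha_lift => /negPf ->; rewrite mul0r.
Qed.
End Basis.

Lemma sign_vecP (rs : subgroup_reps) (u : ghost G) : u \is a GRing.unit ->
  forall i, u (rs i) = (-1) ^+ sign_vec rs u i.
Proof.
move=> /ghost_unitE h i; rewrite /sign_vec.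
by case: (h (rs i)) => ->; rewrite ?eqxx.
Qed.

Lemma subgroup_reps_exist : inhabited subgroup_reps.
Proof.
pose P := [set orbit 'JG%act [set: G] K | K : {group G}].
have ex (i : 'I_#|P|) : exists K : {group G},
    enum_val i == orbit 'JG%act [set: G] K.
  by have /imsetP[K _ ->] := enum_valP i; exists K.
pose r i := xchoose (ex i).
have rE i : enum_val i = orbit 'JG%act [set: G] (r i).
  exact/eqP/(xchooseP (ex i)).
have memE (K L : {group G}) :
    ((K : {set G}) \in (L :^: [set: G])%g) = (K \in orbit 'JG%act [set: G] L).
  apply/imsetP/orbitP => [[x _ e] | [x _ e]]; exists x; rewrite ?inE //.
    exact/val_inj/esym.
  by rewrite -e.
constructor; exists #|P| r => [K | i j].
  have KP : orbit 'JG%act [set: G] K \in P by apply: imset_f.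
  exists (enum_rank_in KP (orbit 'JG%act [set: G] K)).
  by rewrite memE -rE enum_rankK_in ?orbit_refl.
by rewrite memE => /orbit_eqP h; apply: enum_val_inj; rewrite !rE h.
Qed.

Lemma quotient_basis_exist H : inhabited (quotient_basis H).
Proof.
pose E := ('N(H) / radical H)%G.
have [b bE bt] := abelian_structure (E_abelian H : abelian E).
pose e (k : 'I_(size b)) := tnth (in_tuple b) k.
have dE : \big[dprod/1%g]_(k < size b) <[e k]>%g = E.
  by rewrite -bE [RHS]big_tnth.
have eE k : e k \in E.
  have := dE; rewrite (bigD1 k) //= => /dprodP[[K L eK ->] <- _ _].
  by apply: (subsetP (mulG_subl _ _)); rewrite cycle_id.
have e1 k : e k != 1%g.
  rewrite -order_gt1; have := allP (abelian_type_gt1 E) #[e k]%g.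
  by apply; rewrite -bt map_f // mem_tnth.
have e2 k : (e k ^+ 2)%g = 1%g by apply: E_square.
have lift k : exists n, (n \in 'N(H)) && (coset (radical H) n == e k).
  have /morphimP[n _ nN en] := eE k; exists n.
  by rewrite nN en eqxx.
constructor; exists (size b) e (fun k => xchoose (lift k)) => //.
- move=> z zE; have [c [cE -> _]] := mem_bigdprod dE zE.
  have ex k : exists i : 'F_2, c k == (e k ^+ i)%g.
    have /cycleP[i ->] := cE k isT; exists (inZp i).
    by rewrite -(expg_mod i (e2 k)).
  exists [ffun k => xchoose (ex k)]; apply: eq_bigr => k _.
  by rewrite ffunE; apply/eqP/(xchooseP (ex k)).
- move=> a a1; have [c [_ _ cu]] := mem_bigdprod dE (group1 E).
  apply/ffunP => k; rewrite ffunE.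
  have ak : (e k ^+ a k)%g = 1%g.
    rewrite (cu (fun k => e k ^+ a k)%g) //; last by move=> j _; apply: mem_cycle.
    by rewrite -(cu (fun=> 1%g)) // big1.
  have := e1 k; case: (a k) ak => [[|[|]] ? /= h]; rewrite -?h ?expg1 ?eqxx //.
  by move=> _; apply: val_inj.
- by move=> k; case/andP: (xchooseP (lift k)).
- by move=> k; case/andP: (xchooseP (lift k)) => _ /eqP.
Qed.

End System.

(* Main.v *)
(* For a G-set X, [n |-> #|X^(H<n>)|] is the permutation character of N_G(H) on
   X^H. Hence for a unit u of the Burnside ring [n |-> u(H<n>)] is a virtual
   character of N_G(H) of norm 1, i.e. up to sign a linear character with values
   in {1, -1}; it is trivial on the smallest normal subgroup R over H with
   elementary abelian 2-quotient, and is given there by a GF(2)-linear form,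
   which is E(H). Conversely, if [n |-> u(H<n>)/u(H)] is a linear character, its
   sum over N_G(H) is 0 or #|N_G(H)|, so u satisfies the congruences that
   characterize the Burnside ring inside the ghost ring. *)

Require Import Defs.
From mathcomp Require Import all_boot all_fingroup all_algebra.
From mathcomp Require Import all_order all_field all_character.

Set Implicit Arguments.
Unset Strict Implicit.
Unset Printing Implicit Defensive.

Import GroupScope Order.TTheory GRing.Theory Num.Theory.
Local Open Scope ring_scope.

Local Notation adjoin H n := (H <*> <[n]>)%G.

(** * Congruences satisfied by marks *)

Section Marks.
Variable G : finGroupType.
Implicit Types (H K : {group G}) (X Y : gset G) (f u : ghost G).

Lemma fixed_points_adjoin X H n :
  fixed_points X (adjoin H n) =
    [set x in fixed_points X H | gset_act X n x == x].
Proof.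
rewrite !fixed_pointsE afixYin ?subsetT // afix_cycle; apply/setP => x.
rewrite !inE; congr (_ && _); rewrite sub1set inE /=.
by rewrite (can2_eq (g := gset_act X n)) ?[x == _]eq_sym // => y;
  rewrite -lactM ?mulgV ?mulVg lact1.
Qed.

Lemma fixed_points_norm X H n x : n \in 'N(H) ->
  (gset_act X n x \in fixed_points X H) = (x \in fixed_points X H).
Proof.
move=> nN; rewrite !fixed_pointsE.
have := acts_act (acts_fix_norm (right_act X) (subxx 'N(H))) (groupVr nN) x.
by rewrite /= invgK.
Qed.

(** The summand depends only on the coset Hn, so this is the usual congruence modulo |N(H) : H| over
    N(H)/H, with both sides multiplied by |H|. *)
Definition congruent f := forall H,
  (#|'N(H)| %| \sum_(n in 'N(H)) f (adjoin H n))%Z.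

(** Orbit counting for N(H) acting on X^H: the sum is |N(H)| times the number of orbits. *)
Lemma mark_congruent X : congruent (gset_mark X).
Proof.
move=> H; have := Frobenius_Cauchy (acts_fix_norm (right_act X) (subxx 'N(H))).
move=> /(congr1 Posz); rewrite PoszM => e.
suff -> : \sum_(n in 'N(H)) gset_mark X (adjoin H n) =
    (\sum_(n in 'N(H)) #|'Fix_('Fix_(right_act X)(H) | right_act X)[n]|)%N.
  by rewrite e dvdz_mull.
rewrite -natz natr_sum; apply: eq_bigr => n nN.
rewrite gset_markE natz; congr Posz; apply: eq_card => x.
by rewrite fixed_pointsE afixYin ?subsetT // afix_cycle.
Qed.

Lemma congruentB f g : congruent f -> congruent g -> congruent (f - g).
Proof.
move=> hf hg H; have -> : \sum_(n in 'N(H)) (f - g) (adjoin H n) =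
   \sum_(n in 'N(H)) f (adjoin H n) - \sum_(n in 'N(H)) g (adjoin H n).
  by rewrite -sumrB; apply: eq_bigr => n _; rewrite ghostDE ghostNE.
by rewrite rpredB ?hf ?hg.
Qed.

Lemma ghostMzE f (c : int) H : (f *~ c) H = f H *~ c.
Proof.
have nat k : (f *+ k) H = f H *+ k.
  by elim: k => [|k IHk]; rewrite ?ghost0E // !mulrS ghostDE IHk.
by case: c => k; rewrite ?NegzE ?mulrNz -?pmulrn ?ghostNE nat.
Qed.

Lemma congruentMz f c : congruent f -> congruent (f *~ c).
Proof.
move=> hf H; rewrite (eq_bigr (fun n => f (adjoin H n) * c)).
  by rewrite -mulr_suml dvdz_mulr.
by move=> n _; rewrite ghostMzE -mulrzr intz.
Qed.

Lemma burnside_gset_mark X : in_burnside (gset_mark X).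
Proof.
by apply/in_burnsideP; exists X, (gset0 G); rewrite -!class_markE rmorph0 subr0.
Qed.

Lemma in_burnsideD f g : in_burnside f -> in_burnside g -> in_burnside (f + g).
Proof. by case=> a <- [b <-]; exists (a + b); rewrite rmorphD. Qed.

Lemma in_burnsideMz f c : in_burnside f -> in_burnside (f *~ c).
Proof. by case=> a <-; exists (a *~ c); rewrite rmorphMz. Qed.

(** * The transitive G-sets G/H and their marks *)

Section Cosets.
Local Open Scope group_scope.
Variable H : {group G}.

Let T := {A : {set G} | A \in lcosets H [set: G]}.

Fact lcosets_stable g (A : T) : g *: val A \in lcosets H [set: G].
Proof.
case: A => A /= /lcosetsP[x _ ->]; apply/lcosetsP.
by exists (g * x)%g; rewrite ?inE ?lcosetM.
Qed.
Definition lcosets_fun g (A : T) : T := Sub (g *: val A) (lcosets_stable g A).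
Fact lcosets_fun1 A : lcosets_fun 1%g A = A.
Proof. by apply: val_inj; rewrite /= lcoset1. Qed.
Fact lcosets_funM g h A :
  lcosets_fun (g * h)%g A = lcosets_fun g (lcosets_fun h A).
Proof. by apply: val_inj; rewrite /= lcosetM. Qed.
Definition lcosets_gset := GSet (LeftAction lcosets_fun1 lcosets_funM).

Lemma lcosets_fixedP (K : {group G}) (A : lcosets_gset) x : val A = x *: H ->
  (A \in fixed_points lcosets_gset K) = (K \subset H :^ x^-1).
Proof.
move=> eA; rewrite inE; apply/forall_inP/subsetP => h g gK.
  have /eqP/(congr1 val) := h g gK; rewrite /= eA -lcosetM => /lcoset_eqP.
  by rewrite mem_lcoset mem_conjgV conjgE.
apply/eqP/val_inj; rewrite /= eA -lcosetM; apply/lcoset_eqP.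
by rewrite mem_lcoset -conjgE -mem_conjgV h.
Qed.

(** H fixes xH iff H lies in a conjugate of itself by x; equal orders turn this inclusion into x
    normalizing H. *)
Lemma lcosets_mark_self : gset_mark lcosets_gset H = #|'N(H) : H|%:Z%R.
Proof.
rewrite gset_markE; congr Posz; rewrite -card_lcosets -(card_imset _ val_inj).
apply: eq_card => A; apply/imsetP/lcosetsP => [[B] | [x xN ->]].
  have /lcosetsP[x _ eB] := valP B; rewrite (lcosets_fixedP _ eB) => sH ->.
  exists x => //; suff: x^-1 \in 'N(H) by rewrite groupV.
  apply/normP; apply/eqP; rewrite eq_sym.
  by rewrite eqEcard sH cardJg leqnn.
have xH : x *: H \in lcosets H [set: G].
  by apply/lcosetsP; exists x; rewrite ?inE.
exists (Sub (x *: H) xH : T) => //.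
by rewrite (@lcosets_fixedP _ _ x) // (normP _) ?groupV.
Qed.

Lemma lcosets_mark_sub (K : {group G}) : gset_mark lcosets_gset K != 0%R ->
  exists x, K \subset H :^ x.
Proof.
rewrite gset_markE eqz_nat -lt0n => /card_gt0P[A].
have /lcosetsP[x _ eA] := valP A; rewrite (lcosets_fixedP _ eA).
by exists x^-1%g.
Qed.

End Cosets.

(** * Sufficiency of the congruences *)

Lemma congruent_burnside f : congruent f -> in_burnside f.
Proof.
(* If H is maximal in the support of f, the congruence at H reads
   #|N(H) : H| %| f H, so a multiple of the mark of G / H cancels f at H. *)
pose D f :=
  [set H : {group G} | [exists K : {group G}, (H \subset K) && (f K != 0)]].
(* The induction runs on the downward closure [D f] of the support: cancelling f at H may create
   nonzero values, but only at subgroups of conjugates of H, which already lie in [D f]. *)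
have [m] := ubnP #|D f|; elim: m => // m IHm in f *; rewrite ltnS => leDm hf.
case: (pickP (fun K : {group G} => f K != 0)) => [H0 fH0 | f0]; last first.
  have -> : f = 0; last by exists 0; rewrite rmorph0.
  by apply/ghost_eqP => H; rewrite ghost0E; apply/eqP; have := f0 H; case: eqP.
pose H := [arg max_(K > H0 | f K != 0) #|K|].
have [fH maxH] : f H != 0 /\ forall K : {group G}, f K != 0 -> (#|K| <= #|H|)%N.
  by rewrite /H; case: arg_maxnP => // K fK h.
have fK0 (K : {group G}) : (#|H| < #|K|)%N -> f K = 0.
  by move=> lt; apply/eqP; apply: contraLR lt => /maxH; rewrite -leqNgt.
have [c ec] : exists c, f H = c * #|'N(H) : H|%:Z.
  (* For n outside H the group H<n> is larger than H and f vanishes there; the n in H contribute |H|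
     f(H) altogether. *)
  apply/dvdzP; have := hf H; rewrite (bigID (mem H)) /=.
  rewrite [X in (_ + X)]big1 ?addr0; last first.
    move=> n /andP[_ nH]; apply: fK0; apply: proper_card.
    rewrite properEneq joing_subl andbT; apply: contraNneq nH => ->.
    by rewrite mem_gen // inE cycle_id orbT.
  rewrite (eq_bigr (fun=> f H)) => [|n /andP[_ nH]]; last first.
    by congr (f _); apply/val_inj/joing_idPl; rewrite cycle_subG.
  rewrite (eq_bigl (mem H)) => [|n]; last first.
    by rewrite /= andb_idl // => /(subsetP (normG H)).
  rewrite sumr_const -(Lagrange (normG H)) PoszM -mulr_natl natz.
  by rewrite dvdz_mul2l // eqz_nat -lt0n cardG_gt0.
pose g := gset_mark (lcosets_gset H) *~ c.
have gE K : g K = c * gset_mark (lcosets_gset H) K.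
  by rewrite ghostMzE -mulrzr intz mulrC.
rewrite -[f](subrK g); apply: in_burnsideD; last first.
  exact/in_burnsideMz/burnside_gset_mark.
apply: IHm; last by apply: congruentB => //; apply/congruentMz/mark_congruent.
apply: leq_trans leDm; apply: proper_card; apply/properP; split; last first.
  exists H; first by rewrite inE; apply/existsP; exists H; rewrite subxx.
  rewrite inE; apply/existsP => -[K /andP[sHK]]; rewrite ghostDE ghostNE gE.
  case: (eqVneq K H) => [-> | neK].
    by rewrite lcosets_mark_self ec subrr eqxx.
  have ltHK : (#|H| < #|K|)%N.
    by rewrite proper_card // properEneq sHK eq_sym neK.
  rewrite fK0 //; suff -> : gset_mark (lcosets_gset H) K = 0.
    by rewrite mulr0 subrr eqxx.
  apply/eqP; apply: contraLR ltHK => /lcosets_mark_sub[x /subset_leq_card].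
  by rewrite cardJg -leqNgt.
apply/subsetP => L; rewrite !inE => /existsP[K /andP[sLK]].
rewrite ghostDE ghostNE gE; have [fK | fK _] := eqVneq (f K) 0; last first.
  by apply/existsP; exists K; rewrite sLK.
rewrite fK sub0r oppr_eq0 mulf_eq0 negb_or => /andP[_ /lcosets_mark_sub[x sKH]].
apply/existsP; exists (H :^ x)%G; rewrite (subset_trans sLK sKH).
by have /class_constantP-> := ghost_funP f.
Qed.

(** * The permutation character of N(H) on X^H *)

Section FixRepr.
Variables (X : gset G) (H : {group G}).
Let S := fixed_points X H.

(** Images are recorded in columns, so that a left action gives a homomorphism for the matrix
    product. *)
Definition fix_mx g : 'M[algC]_#|S| :=
  \matrix_(i, j) (gset_act X g (enum_val j) == enum_val i)%:R.

Fact fix_mx_repr : mx_repr 'N(H)%G fix_mx.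
Proof.
split=> [|g h gN hN]; apply/matrixP => i k; rewrite !mxE.
  by rewrite lact1 (inj_eq enum_val_inj) eq_sym.
have hS : gset_act X h (enum_val k) \in S.
  by rewrite fixed_points_norm // enum_valP.
rewrite (bigD1 (enum_rank_in hS (gset_act X h (enum_val k)))) //= !mxE.
rewrite enum_rankK_in // eqxx mulr1 -lactM big1 ?addr0 // => j jne.
rewrite !mxE -[gset_act X h _](enum_rankK_in hS hS) (inj_eq enum_val_inj).
by rewrite [_ == j]eq_sym (negPf jne) mulr0.
Qed.

Definition fix_char : 'CF('N(H)) := cfRepr (MxRepresentation fix_mx_repr).

Lemma fix_charE n : n \in 'N(H) ->
  fix_char n = (gset_mark X (adjoin H n))%:~R.
Proof.
move=> nN; rewrite cfunE nN mulr1n gset_markE /mxtrace -pmulrn.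
under eq_bigr do rewrite mxE.
rewrite -(big_enum_val (A := mem S) (fun x => (gset_act X n x == x)%:R)) /=.
rewrite -natr_sum; congr _%:R.
rewrite fixed_points_adjoin -sum1_card big_mkcond /=.
by rewrite [RHS]big_mkcond /=; apply: eq_bigr => x _; rewrite inE; case: ifP.
Qed.

End FixRepr.

(** * Units and linear characters of normalizers *)

(* [n |-> u(H<n>) / u(H)] is multiplicative on N_G(H), denominators cleared. *)
Definition multiplicative u := forall H, {in 'N(H) &, forall n m,
  u (adjoin H (n * m)) * u H = u (adjoin H n) * u (adjoin H m)}.

Lemma adjoin1 H : adjoin H 1%g = H.
Proof. by apply/val_inj/joing_idPl; rewrite cycle_subG. Qed.

Lemma burnside_unit_multiplicative u :
  u \is a GRing.unit -> in_burnside u -> multiplicative u.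
Proof.
move=> /ghost_unitE u1 /in_burnsideP[X [Y eu]] H n m nN mN.
pose phi := fix_char X H - fix_char Y H.
have phiE x : x \in 'N(H) -> phi x = (u (adjoin H x))%:~R.
  move=> xN; rewrite eu ghostDE ghostNE rmorphB /= -!fix_charE //.
  by rewrite /phi !cfunE.
have phiZ : phi \in 'Z[irr 'N(H)].
  by rewrite rpredB // char_vchar // cfRepr_char.
have norm_phi : '[phi] = 1.
  rewrite (cfnormE (cfun_onG phi)) (eq_bigr (fun=> 1)) => [|x xN].
    by rewrite sumr_const -mulr_natl mulr1 mulVf // neq0CG.
  rewrite phiE //.
  by case: (u1 (adjoin H x)) => ->; rewrite ?normrN normr1 expr1n.
have [b [i phi_i]] := vchar_norm1P phiZ norm_phi.
(* The degree of ['chi_i] is |phi(1)| = |u(H)| = 1. *)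
have lin_i : 'chi_i \is a linear_char.
  rewrite qualifE /= irr_char /=; have := irr1_gt0 i.
  have : `|phi 1%g| = 1.
    rewrite phiE ?group1 //.
    by case: (u1 (adjoin H 1%g)) => ->; rewrite ?normrN normr1.
  by rewrite phi_i cfunE normrMsign => + /gtr0_norm => -> ->.
apply: (@intr_inj algC).
(* With u(H) read as phi(1), both sides carry the square of the sign [(-1) ^+ b]. *)
rewrite !rmorphM /= -{2}[H]adjoin1 -!phiE ?groupM ?group1 //.
rewrite phi_i !cfunE lin_char1 // lin_charM // mulr1.
by rewrite mulrAC [RHS]mulrACA.
Qed.

Lemma multiplicative_congruent u :
  u \is a GRing.unit -> multiplicative u -> congruent u.
Proof.
move=> /ghost_unitE u1 mu H.
have [const | ] := boolP [forall n in 'N(H), u (adjoin H n) == u H].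
  rewrite (eq_bigr (fun=> u H)) => [|n nN]; last exact/eqP/(forall_inP const).
  by rewrite sumr_const -mulr_natl natz dvdz_mulr.
case/forall_inPn => a aN ua.
have {}ua : u (adjoin H a) = - u H.
  by move: ua; case: (u1 H) (u1 (adjoin H a)) => -> [] ->; rewrite ?opprK ?eqxx.
have uu : u H * u H = 1 by case: (u1 H) => ->; rewrite ?mulrNN mulr1.
set s := \sum_(n in _) _; suff -> : s = 0 by rewrite dvdz0.
(* Translation by [a], where the character takes the value -1, negates every summand. *)
have sN : s = - s.
  rewrite {1}/s (reindex_inj (mulIg a)) /= -sumrN; apply: eq_big => [n | n nN].
    by rewrite groupMr.
  have nN' : n \in 'N(H) by rewrite -(groupMr n aN).
  by rewrite -[LHS]mulr1 -uu mulrA mu // ua mulrN mulNr -mulrA uu mulr1.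
by apply/eqP; rewrite -[_ == 0](mulrn_eq0 s 2) mulr2n {1}sN addNr.
Qed.

End Marks.

Local Arguments qb_lift {G H} q k.
Local Arguments qb_lift_mem {G H} q k.

(** * Translation into linear systems over GF(2) *)

Section Equivalence.
Variables (G : finGroupType) (rs : subgroup_reps G).
Implicit Types (H K : {group G}).

Lemma addF2 (a : 'F_2) : a + a = 0.
Proof. by case: a => [[|[|]] ?] //; apply: val_inj. Qed.

Lemma signF2D (a b : 'F_2) : (-1) ^+ (a + b)%R = (-1) ^+ a * (-1) ^+ b :> int.
Proof. by case: a b => [[|[|]] ?] // [[|[|]] ?]. Qed.

Lemma signF2_inj (a b : 'F_2) : (-1) ^+ a = (-1) ^+ b :> int -> a = b.
Proof. by case: a b => [[|[|]] ?] // [[|[|]] ?] // _; apply: val_inj. Qed.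

Section Unit.
Variables (u : ghost G) (hu : u \is a GRing.unit).

Let v K := sign_vec u (rep_index rs K).

Lemma sign_vec_rep K : u K = (-1) ^+ v K.
Proof.
rewrite -sign_vecP //; have /imsetP[x _ eK] := xchooseP (rep_cover rs K).
have /class_constantP uJ := ghost_funP u; rewrite -[RHS](uJ _ x).
congr (ghost_fun u _); apply: val_inj.
by rewrite /= eK.
Qed.

(** The exponent of the sign u(H<n>)/u(H); multiplicativity of u becomes additivity of [w H]. *)
Let w H n := v H + v (adjoin H n).

Lemma multiplicativeE : multiplicative u <->
  forall H, {in 'N(H) &, {morph w H : n m / (n * m)%g >-> n + m}}.
Proof.
have wE H n m :
    (u (adjoin H (n * m)) * u H = u (adjoin H n) * u (adjoin H m)) <->
    (w H (n * m)%g = w H n + w H m).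
  rewrite !sign_vec_rep -!signF2D /w addrACA addF2 add0r [v H + _]addrC.
  by split=> [/signF2_inj | ->].
by split=> mu H n m nN mN; apply/wE/mu.
Qed.

Section Basis.
Variables (H : {group G}) (e : quotient_basis H).

Lemma norm_radical : 'N(H) \subset 'N(radical H).
Proof. by have /and3P[_ /normal_norm] := radicalP H. Qed.

Lemma alphaD :
  {in 'N(H) &, forall n m, alpha e (n * m)%g = alpha e n + alpha e m}.
Proof.
move=> n m nN mN; apply: (@comb_inj _ _ e); rewrite combD -!alphaP ?groupM //.
by rewrite morphM ?(subsetP norm_radical).
Qed.

(** The equations make [w H] a linear form in the coordinates [alpha], which are themselves additive
    on N(H). *)
Lemma satisfies_E_morph : satisfies_E rs e u ->
  {in 'N(H) &, {morph w H : n m / (n * m)%g >-> n + m}}.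
Proof.
case/E_solutionP => l hl n m nN mN.
have wE x : x \in 'N(H) -> w H x = - \sum_k alpha e x k * l k.
  by move=> /hl/eqP; rewrite /E_eqn -addrA addr_eq0 => /eqP ->; rewrite opprK.
rewrite !wE ?groupM // -opprD -big_split /=; congr (- _).
by apply: eq_bigr => k _; rewrite alphaD // ffunE mulrDl.
Qed.

(** The kernel K of [w H] contains H and all commutators and squares of N(H), hence the radical. So
    [w H] factors through N(H)/R, where its values on a basis determine it. *)
Lemma morph_satisfies_E :
  {in 'N(H) &, {morph w H : n m / (n * m)%g >-> n + m}} -> satisfies_E rs e u.
Proof.
move=> wD.
have w1 : w H 1%g = 0 by rewrite /w adjoin1 addF2.
pose K := [set n in 'N(H) | w H n == 0].
have KE n : (n \in K) = (n \in 'N(H)) && (w H n == 0) by rewrite inE.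
have gK : group_set K.
  apply/group_setP; split=> [|x y]; first by rewrite KE group1 w1 eqxx.
  rewrite !KE => /andP[xN /eqP wx] /andP[yN /eqP wy].
  by rewrite (groupM xN yN) wD // wx wy addr0 eqxx.
have wV x : x \in 'N(H) -> w H x^-1%g = w H x.
  move=> xN; apply: (addrI (w H x)).
  by rewrite -wD ?groupV // mulgV w1 addF2.
have sRK : radical H \subset Group gK.
  apply: radical_min; apply/elem2_overP; split=> /=.
  - apply/subsetP => h hH; rewrite KE (subsetP (normG H)) // /w.
    rewrite (_ : adjoin H h = H) ?addF2 //.
    by apply/val_inj/joing_idPl; rewrite cycle_subG.
  - apply/andP; split; first by apply/subsetP => n; rewrite KE => /andP[].
    apply/normsP => x xN; apply/setP => n.
    rewrite mem_conjg !KE groupJr ?groupV //.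
    apply: andb_id2l => nN; rewrite conjgE invgK.
    by rewrite !wD ?groupM ?groupV // wV // addrCA addF2 addr0.
  - rewrite -[K]/(gval (Group gK)) gen_subG /=.
    apply/subsetP => _ /imset2P[x y xN yN ->].
    rewrite KE commgEl conjgE !groupM ?groupV //=.
    by rewrite !wD ?groupM ?groupV // !wV // addrA addF2.
  - by move=> x xN; rewrite KE groupX //= expgS expg1 wD // addF2.
have w_coset x y : x \in 'N(H) -> y \in 'N(H) ->
    coset (radical H) x = coset (radical H) y -> w H x = w H y.
  move=> xN yN exy; suff : (x * y^-1)%g \in K.
    rewrite KE wD ?groupV // wV // => /andP[_ /eqP wxy].
    by apply: (addIr (w H y)); rewrite wxy addF2.
  apply: (subsetP sRK); apply: coset_idr.
    by rewrite groupM ?groupV ?(subsetP norm_radical).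
  by rewrite morphM ?morphV ?groupV ?(subsetP norm_radical) //= exy mulgV.
(* Since [w H] is defined on N(H) and not on the quotient, the induction carries a lift x of the
   partial product. *)
have w_prod (a : {ffun 'I_(qb_dim e) -> 'F_2}) :
    exists x, [/\ x \in 'N(H), coset (radical H) x = comb e a
            & w H x = \sum_k a k * w H (qb_lift e k)].
  rewrite /comb; elim/big_rec2: _ => [|k s z _ [x [xN xz wx]]].
    by exists 1%g; rewrite group1 morph1 w1.
  have eN := qb_lift_mem e k.
  exists (qb_lift e k ^+ a k * x)%g; split; first by rewrite groupM ?groupX.
    rewrite morphM ?groupX ?(subsetP norm_radical) //.
    by rewrite morphX ?(subsetP norm_radical) //= qb_liftE xz.
  rewrite wD ?groupX // wx; congr (_ + _).
  case: (a k) => [[|[|]] ?] //=; rewrite ?expg0 ?expg1.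
    by rewrite w1 (_ : Ordinal _ = 0) ?mul0r //; apply: val_inj.
  by rewrite (_ : Ordinal _ = 1) ?mul1r //; apply: val_inj.
(* These values are forced by the equations at the lifts of the basis; they are those of
   [E_subst]. *)
apply/E_solutionP; exists (fun k => - w H (qb_lift e k)) => n nN.
have [x [xN ex wx]] := w_prod (alpha e n).
have wn : w H n = w H x by apply: w_coset; rewrite // ex (alphaP e).
rewrite /E_eqn -addrA -[X in _ + X]/(w H n) wn wx -big_split big1 //= => k _.
by rewrite mulrN addNr.
Qed.

End Basis.
End Unit.
End Equivalence.

Theorem theorem2p1 (G : finGroupType)
    (rs : subgroup_reps G)
    (e : forall H : {group G}, quotient_basis H)
    (u : ghost G) (hu : u \is a GRing.unit) :
  in_burnside u <-> forall H : {group G}, satisfies_E rs (e H) u.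
Proof.
split=> [inu H | Eu].
  have /(multiplicativeE rs hu) uM := burnside_unit_multiplicative hu inu.
  exact/morph_satisfies_E/uM.
apply/congruent_burnside/multiplicative_congruent => //.
apply/(multiplicativeE rs hu) => // H.
exact/satisfies_E_morph/Eu.
Qed.
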